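(* For $k\ge1$ let $S_k$ be the graph with vertex set $\{x_i,y_i:1\le i\le k\}$ and edges $x_iy_j$ exactly when $j=i$ or $j\ge i+2$, and let $S_k^\circ$ be the labelled graph obtained by labelling $x_1,y_1,x_k,y_k$ with the label ''white'' and all other vertices with the label ''black'', where white and black are incomparable labels. Then $\{S_k^\circ\}_{k}$ is a canonical labelled infinite antichain for the class of bichain graphs under the labelled induced subgraph ordering.
   Context: A bichain graph is a bipartite graph admitting a bipartition in which each of the two parts can be divided into at most two chains, a chain being a set of vertices whose neighbourhoods are linearly ordered by inclusion. For a quasi-ordered set $(W,\le)$, $(H,k)$ with $k:V(H)\to W$ is a labelled induced subgraph of $(G,\ell)$ with $\ell:V(G)\to W$ if there is an injective $\phi:V(H)\to V(G)$ with $uv\in E(H)\iff \phi(u)\phi(v)\in E(G)$ and $k(v)\le\ell(\phi(v))$ for all $v$. A class of graphs is labelled well-quasi-ordered if for every well-quasi-ordered $(W,\le)$ the $W$-labelled graphs with underlying graphs in the class contain no infinite antichain under this relation. A labelled infinite antichain $\mathcal{A}$ in a hereditary class $\mathcal{C}$ is canonical if every hereditary subclass of $\mathcal{C}$ that contains only finitely many of the underlying unlabelled graphs of $\mathcal{A}$ is labelled well-quasi-ordered.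
   Formalization: The family is taken over k ≥ 2 instead of k ≥ 1: S_1° is a single edge with two white ends, which embeds in every S_k° as x_1y_1, so the family including k = 1 is not an antichain; the canonicity condition is unaffected. *)

(* Defs.v *)
From HB Require Import structures.
From mathcomp Require Import all_boot.
Set Implicit Arguments. Unset Strict Implicit. Unset Printing Implicit Defensive.

Record graph := Graph {
  gV : finType;
  gadj : rel gV;
  gsym : symmetric gadj;
  girr : irreflexive gadj }.
Arguments gadj : clear implicits.

Definition induced_emb (H G : graph) (phi : gV H -> gV G) : Prop :=
  injective phi /\ forall u v, gadj G (phi u) (phi v) = gadj H u v.

Definition induced_sub (H G : graph) : Prop := exists phi, @induced_emb H G phi.

Record lgraph (W : Type) := LGraph { lg : graph; lab : gV lg -> W }.
Arguments lg {W}.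
Arguments lab {W}.

Definition lsub (W : Type) (le : W -> W -> Prop) (H G : lgraph W) : Prop :=
  exists phi : gV (lg H) -> gV (lg G),
    induced_emb phi /\ forall v, le (lab H v) (lab G (phi v)).

Definition quasi_order (W : Type) (le : W -> W -> Prop) : Prop :=
  (forall x, le x x) /\ (forall x y z, le x y -> le y z -> le x z).

Definition wqo (W : Type) (le : W -> W -> Prop) : Prop :=
  quasi_order le /\ forall f : nat -> W, exists i j, (i < j)%N /\ le (f i) (f j).

Definition infinite_antichain (X : Type) (R : X -> X -> Prop) (A : nat -> X) : Prop :=
  forall i j, i <> j -> ~ R (A i) (A j).

Definition hereditary (C : graph -> Prop) : Prop :=
  forall G H, C G -> induced_sub H G -> C H.

Definition labelled_wqo (C : graph -> Prop) : Prop :=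
  forall (W : Type) (le : W -> W -> Prop), wqo le ->
    ~ exists A : nat -> lgraph W,
        (forall i, C (lg (A i))) /\ infinite_antichain (@lsub W le) A.

Definition labelled_infinite_antichain (C : graph -> Prop) (W : Type)
    (le : W -> W -> Prop) (A : nat -> lgraph W) : Prop :=
  wqo le /\ (forall i, C (lg (A i))) /\ infinite_antichain (@lsub W le) A.

Definition canonical_antichain (C : graph -> Prop) (W : Type)
    (le : W -> W -> Prop) (A : nat -> lgraph W) : Prop :=
  labelled_infinite_antichain C le A /\
  forall D : graph -> Prop, hereditary D -> (forall G, D G -> C G) ->
    (exists N, forall i, (N <= i)%N -> ~ D (lg (A i))) ->
    labelled_wqo D.

Definition nbhd (G : graph) (u : gV G) : {set gV G} := [set w | gadj G u w].

Definition is_chain (G : graph) (X : {set gV G}) : Prop :=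
  forall u v, u \in X -> v \in X -> nbhd u \subset nbhd v \/ nbhd v \subset nbhd u.

Definition bichain (G : graph) : Prop :=
  exists A1 A2 B1 B2 : {set gV G},
    [disjoint (A1 :|: A2) & (B1 :|: B2)] /\
    (A1 :|: A2) :|: (B1 :|: B2) = setT /\
    (forall u v, u \in A1 :|: A2 -> v \in A1 :|: A2 -> ~~ gadj G u v) /\
    (forall u v, u \in B1 :|: B2 -> v \in B1 :|: B2 -> ~~ gadj G u v) /\
    is_chain A1 /\ is_chain A2 /\ is_chain B1 /\ is_chain B2.

(* The graphs S_k: vertices x_i = inl i, y_j = inr j (0-based, i,j < k);
   x_i y_j is an edge iff j = i or j >= i + 2. *)
Definition S_adj (k : nat) (u v : 'I_k + 'I_k) : bool :=
  match u, v with
  | inl i, inr j | inr j, inl i => (nat_of_ord j == nat_of_ord i) || (i.+2 <= j)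
  | _, _ => false
  end.
Arguments S_adj : clear implicits.

Lemma S_adj_sym k : symmetric (S_adj k).
Proof. by case=> a [] b. Qed.

Lemma S_adj_irr k : irreflexive (S_adj k).
Proof. by case. Qed.

Definition S_graph (k : nat) : graph :=
  @Graph ('I_k + 'I_k)%type (S_adj k) (@S_adj_sym k) (@S_adj_irr k).

Inductive colour := White | Black.
Definition colour_le (a b : colour) : Prop := a = b.

Definition S_lab (k : nat) (v : 'I_k + 'I_k) : colour :=
  match v with
  | inl i | inr i => if (nat_of_ord i == 0) || (nat_of_ord i == k.-1) then White else Black
  end.
Arguments S_lab : clear implicits.

Definition S_circ (k : nat) : lgraph colour := @LGraph colour (S_graph k) (S_lab k).

(* Main.v *)
(* Orient a bichain graph: for a on the left and b on the right put a < b if ab is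
   an edge and b < a otherwise, and order each chain by its neighbourhoods.  This
   is a linear order on the union of any two of the four chains lying on opposite
   sides, but around the 4-cycle of chains the orders may wind: a descending path
   can climb after one turn.  The graph S_k is precisely such a spiral.
   Cut the graph into the pieces that have no proper nonempty lower set.  Within a
   piece, measure how far along the spiral starting at a minimal vertex each vertex
   first occurs; only equal or consecutive levels interleave, and the number of
   levels is bounded when some S_k is excluded.  So a piece is a word over a fixed
   finite alphabet, the graph is a word over such words, and Higman's lemma, applied
   twice, gives labelled well-quasi-order. *)
Require Import Defs.
From mathcomp Require Import all_boot boolp zify.
Set Implicit Arguments. Unset Strict Implicit. Unset Printing Implicit Defensive.

(** * Higman's lemma *)


Section IncreasingSubsequence.
Variables (X : Type) (le : X -> X -> Prop).

(** Indices with no later entry above theirs are bounded, since infinitely many of them would form a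
    bad sequence. Past the bound, jumping repeatedly to a later entry above gives the
    subsequence. *)
Lemma wqo_subseq (f : nat -> X) : wqo le ->
  exists g : nat -> nat, {homo g : i j / i < j} /\
    forall i j, i <= j -> le (f (g i)) (f (g j)).
Proof.
move=> [[lexx letr] goodP].
pose terminal i := forall j, i < j -> ~ le (f i) (f j).
have [N NT]: exists N, forall i, N <= i -> exists j, i < j /\ le (f i) (f j).
  apply: contrapT => nN.
  have infT : forall n, exists i, n < i /\ terminal i.
    move=> n; apply: contrapT => nT; apply: nN; exists n.+1 => i lt_ni.
    apply: contrapT => nj; apply: nT; exists i; split=> // j ij lij.
    by apply: nj; exists j.
  have [h hP] := choice infT.
  pose g n := iter n.+1 h 0.
  have gS n : g n < g n.+1 by exact: (hP _).1.
  have g_lt : {homo g : i j / i < j} by exact: (homo_ltn ltn_trans).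
  have [i [j [ij lij]]] := goodP (f \o g).
  exact: (hP (iter i h 0)).2 (g j) (g_lt _ _ ij) lij.
have /choice [h hP] : forall i, exists j, N <= i -> i < j /\ le (f i) (f j).
  move=> i; case: (leqP N i) => [/NT [j jP]|_]; first by exists j.
  by exists 0.
pose g n := iter n h N.
have gN n : N <= g n.
  by elim: n => //= n IH; apply: leq_trans IH (ltnW (hP _ IH).1).
exists g; split; first by apply: (homo_ltn ltn_trans) => n; exact: (hP _ (gN n)).1.
move=> i j; elim: j => [|j IH]; first by rewrite leqn0 => /eqP ->.
rewrite leq_eqVlt => /predU1P [->|]; first exact: lexx.
by rewrite ltnS => /IH lij; apply: letr lij (hP _ (gN j)).2.
Qed.

End IncreasingSubsequence.

Lemma nat_fin_collision (L : finType) (f : nat -> L) :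
  exists i j, i < j /\ f i = f j.
Proof.
pose h (i : 'I_(#|L|.+1)) := f i.
have /injectivePn [i [j neq_ij eq_h]] : ~~ injectiveb h.
  apply/negP => /injectiveP /leq_card; by rewrite card_ord ltnn.
case: (ltngtP i j) => [ij|ji|/ord_inj /eqP eij].
- by exists i, j.
- by exists j, i.
- by rewrite eij in neq_ij.
Qed.

Definition lab_le (L : Type) (W : Type) (le : W -> W -> Prop) (p q : L * W) :=
  p.1 = q.1 /\ le p.2 q.2.

Lemma wqo_lab (L : finType) (W : Type) (le : W -> W -> Prop) :
  wqo le -> wqo (@lab_le L W le).
Proof.
move=> wle; have [[lexx letr] _] := wle; split; first split.
- by move=> [l w]; split => //; exact: lexx.
- move=> p q r [pq1 pq2] [qr1 qr2]; split; first by rewrite pq1.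
  exact: letr pq2 qr2.
move=> f; have [g [g_lt gP]] := wqo_subseq (fun n => (f n).2) wle.
have [i [j [ij eq_ij]]] := nat_fin_collision (fun n => (f (g n)).1).
by exists (g i), (g j); split; [exact: g_lt|split=> //; exact: gP (ltnW ij)].
Qed.

Section Higman.
Variables (X : Type) (le : X -> X -> Prop).

Fixpoint emb (u v : seq X) {struct v} : Prop :=
  match v with
  | [::] => u = [::]
  | y :: v' => emb u v' \/
      match u with [::] => False | x :: u' => le x y /\ emb u' v' end
  end.

Lemma emb0s v : emb [::] v.
Proof. by elim: v => //= y v IH; left. Qed.

Lemma emb_cons x u y v : le x y -> emb u v -> emb (x :: u) (y :: v).
Proof. by move=> lxy uv; right. Qed.

Lemma emb_refl u : (forall x, le x x) -> emb u u.
Proof. by move=> lexx; elim: u => //= x u IH; right. Qed.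

Lemma emb_trans u v w : (forall x y z, le x y -> le y z -> le x z) ->
  emb u v -> emb v w -> emb u w.
Proof.
move=> letr; elim: w u v => [|z w IH] u v /= uv; first by move=> v0; rewrite v0 in uv.
move=> [vw|]; first by left; apply: IH uv vw.
case: v uv => // y v /= [uv|]; first by move=> [_ vw]; left; apply: IH uv vw.
case: u => // x u [xy uv] [yz vw]; right; split; first exact: letr xy yz.
exact: IH uv vw.
Qed.

Definition bad (f : nat -> seq X) := forall i j, i < j -> ~ emb (f i) (f j).

Definition agree n (f g : nat -> seq X) := forall i, i < n -> g i = f i.

Lemma bad_minimal n f : bad f -> exists g, [/\ bad g, agree n f g &
  forall h, bad h -> agree n f h -> size (g n) <= size (h n)].
Proof.
move=> bad_f; pose P m := exists g, [/\ bad g, agree n f g & size (g n) = m].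
have [m [[g [bg ag <-]] mP]] : exists m, P m /\ forall k, P k -> m <= k.
  have exP : exists m, `[< P m >].
    by exists (size (f n)); apply/asboolP; exists f; split.
  case: (ex_minnP exP) => m /asboolP Pm mP; exists m; split=> // k Pk.
  by apply: mP; apply/asboolP.
by exists g; split=> // h bh ah; apply: mP; exists h.
Qed.

(* Nash-Williams' minimal bad sequence argument. *)
Lemma higman : wqo le -> wqo emb.
Proof.
move=> wle; have [[lexx letr] _] := wle; split; first split.
- by move=> u; exact: emb_refl.
- by move=> u v w; exact: emb_trans.
move=> f; apply: contrapT => f_bad.
have {}f_bad : bad f by move=> i j ij eij; apply: f_bad; exists i, j.
have /choice [next nextP] : forall nf : nat * (nat -> seq X), exists g,
    bad nf.2 -> [/\ bad g, agree nf.1 nf.2 g &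
      forall h, bad h -> agree nf.1 nf.2 h -> size (g nf.1) <= size (h nf.1)].
  move=> [n h]; case: (pselect (bad h)) => [/(bad_minimal n) [g gP]|nb].
    by exists g.
  by exists h.
(* Round [n] chooses entry [n] of least possible length and keeps the earlier ones, so the diagonal
   [m] below is bad and minimal at every index. *)
pose fix F n := if n is m.+1 then next (m, F m) else f.
have F_bad n : bad (F n) by elim: n => //= n /(nextP (n, F n)) [].
have F_agree n k i : i < n -> F (n + k) i = F n i.
  elim: k => [|k IH] lt_in; first by rewrite addn0.
  have [_ ag _] := nextP (n + k, F (n + k)) (F_bad (n + k)).
  by rewrite addnS /= ag /= ?IH //; apply: leq_trans lt_in _; exact: leq_addr.
pose m n := F n.+1 n.
have mE n i : i < n -> F n i = m i.
  by move=> lt_in; rewrite -(subnKC lt_in) F_agree.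
have m_bad : bad m.
  move=> i j ij; rewrite -(mE j.+1 i); last exact: leqW.
  exact: F_bad.
have m_min n h : bad h -> agree n m h -> size (m n) <= size (h n).
  move=> bh ah; have [_ _ minP] := nextP (n, F n) (F_bad n).
  by apply: minP => // i lt_in; rewrite ah //= mE.
have /choice [xw xwP] : forall n, exists p, m n = p.1 :: p.2.
  move=> n; case E: (m n) => [|x w]; last by exists (x, w).
  by case: (m_bad n n.+1 (ltnSn n)); rewrite E; exact: emb0s.
have [g [g_lt gP]] := wqo_subseq (fun n => (xw n).1) wle.
(* From index [g 0] on, use the tails along the monotone subsequence of heads. A good pair of [h]
   would give one of [m], yet the entry of [h] at [g 0] is too short. *)
pose h n := if n < g 0 then m n else (xw (g (n - g 0))).2.
have h_bad : bad h.
  move=> i j ij; rewrite /h; case: (ltnP j (g 0)) => gj.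
    by rewrite (ltn_trans ij gj); exact: m_bad.
  case: (ltnP i (g 0)) => gi.
    move=> eij; apply: (m_bad i (g (j - g 0))).
      apply: leq_trans gi _; have [->//|] := posnP (j - g 0).
      by move/g_lt/ltnW.
    by rewrite (xwP (g _)) /=; left.
  move=> eij; have lt_ij : i - g 0 < j - g 0 by rewrite ltn_sub2r // (leq_ltn_trans gi).
  apply: (m_bad (g (i - g 0)) (g (j - g 0))); first exact: g_lt.
  rewrite (xwP (g (i - _))) (xwP (g (j - _))); apply: emb_cons => //.
  exact: gP (ltnW lt_ij).
have := m_min (g 0) h h_bad; rewrite {2}/h ltnn subnn (xwP (g 0)) ltnn.
suff ag : agree (g 0) m h by move=> /(_ ag).
by move=> i lt_i; rewrite /h lt_i.
Qed.

End Higman.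

(** * The graphs S_k *)


Lemma colour_wqo : wqo colour_le.
Proof.
split; first by split=> [x|x y z] //; rewrite /colour_le => -> ->.
move=> f; rewrite /colour_le.
case E0: (f 0); case E1: (f 1); case E2: (f 2);
  solve [ by exists 0, 1; rewrite E0 E1 | by exists 0, 2; rewrite E0 E2
        | by exists 1, 2; rewrite E1 E2 ].
Qed.

(** Indices of equal parity never differ by one, so within a parity class the neighbourhoods of the
    [x_i] decrease and those of the [y_i] increase. *)
Lemma S_graph_bichain k : bichain (S_graph k).
Proof.
pose X p : {set gV (S_graph k)} :=
  [set v | if v is inl i then odd (nat_of_ord i) == p else false].
pose Y p : {set gV (S_graph k)} :=
  [set v | if v is inr i then odd (nat_of_ord i) == p else false].
exists (X true), (X false), (Y true), (Y false); split.
  by rewrite disjoint_subset; apply/subsetP => -[i|i]; rewrite !inE.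
split; first by apply/setP => -[i|i]; rewrite !inE; case: odd.
split; first by move=> [i|i] [j|j]; rewrite !inE.
split; first by move=> [i|i] [j|j]; rewrite !inE.
have chX p : is_chain (X p).
  have sub (i j : 'I_k) : odd i = odd j -> i <= j ->
      @nbhd (S_graph k) (inl j) \subset @nbhd (S_graph k) (inl i).
    by move=> oij le_ij; apply/subsetP => -[l|l]; rewrite !inE //=; lia.
  move=> [i|i] [j|j]; rewrite !inE // => /eqP pi /eqP pj.
  by case: (leqP i j) => [|/ltnW] le_ij; [right|left]; apply: sub; rewrite // pi pj.
have chY p : is_chain (Y p).
  have sub (i j : 'I_k) : odd i = odd j -> i <= j ->
      @nbhd (S_graph k) (inr i) \subset @nbhd (S_graph k) (inr j).
    by move=> oij le_ij; apply/subsetP => -[l|l]; rewrite !inE //=; lia.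
  move=> [i|i] [j|j]; rewrite !inE // => /eqP pi /eqP pj.
  by case: (leqP i j) => [|/ltnW] le_ij; [left|right]; apply: sub; rewrite // pi pj.
by split=> //; split.
Qed.

(** The white vertices: the first component selects the [x] side, the second the last index. *)
Definition S_corner n (p : bool * bool) : gV (S_graph n.+1) :=
  let i := if p.2 then ord_max else ord0 in if p.1 then inl i else inr i.

Lemma S_corner_inj n : injective (@S_corner n.+1).
Proof.
by move=> [[] []] [[] []] //=; rewrite /S_corner /= => -[].
Qed.

Lemma S_corner_lab n p : S_lab n.+1 (S_corner n p) = White.
Proof. by case: p => [[] []] //=; rewrite eqxx ?orbT. Qed.

Lemma S_corner_white n (v : gV (S_graph n.+1)) :
  S_lab n.+1 v = White -> exists p, v = S_corner n p.
Proof.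
case: v => i /=; case: ifP => // /orP [] /eqP Ei _.
- by exists (true, false); congr inl; apply: val_inj.
- by exists (true, true); congr inl; apply: val_inj.
- by exists (false, false); congr inr; apply: val_inj.
- by exists (false, true); congr inr; apply: val_inj.
Qed.

(** The corners induce two disjoint edges in [S_2] and a path on four vertices in every larger
    [S_k]. *)
Lemma S_corner_adj n p q : S_adj n.+2 (S_corner n.+1 p) (S_corner n.+1 q) =
  (p.1 (+) q.1) &&
  (if p.1 then (if n is 0 then p.2 == q.2 else p.2 ==> q.2)
   else (if n is 0 then p.2 == q.2 else q.2 ==> p.2)).
Proof.
by case: n => [|n]; case: p => [[] []]; case: q => [[] []] //=; rewrite ?eqxx ?ltnn.
Qed.

(** This reflection reverses the path of corners; it reduces the reversed case of the antichain
    proof to the case of fixed corners. *)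
Definition S_rev n (v : gV (S_graph n)) : gV (S_graph n) :=
  match v with inl i => inr (rev_ord i) | inr i => inl (rev_ord i) end.

Lemma S_rev_emb n : induced_emb (@S_rev n).
Proof.
split.
  by move=> [i|i] [j|j] // -[E]; congr (_ _); apply: val_inj => /=; have := ltn_ord i;
    have := ltn_ord j; lia.
move=> [i|i] [j|j] //=; have := ltn_ord i; have := ltn_ord j; lia.
Qed.

(** Induction from the low end shows that [phi] preserves the index and side of every vertex. In a
    larger target, the last [x] of the source would keep its index and yet go to the last [x] of the
    target. *)
Lemma S_emb_fixed m n (phi : gV (S_graph m.+3) -> gV (S_graph n.+2)) :
  induced_emb phi -> (forall p, phi (S_corner m.+2 p) = S_corner n.+1 p) ->
  m.+3 = n.+2.
Proof.
move=> [inj_phi adjP] corner.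
have phix0 := corner (true, false); have phiy0 := corner (false, false).
have phixl := corner (true, true); have phiyl := corner (false, true).
apply/eqP; rewrite eqn_leq; apply/andP; split.
  by have := leq_card _ inj_phi; rewrite !card_sum !card_ord; lia.
rewrite leqNgt; apply/negP => lt_mn.
rewrite /S_corner /= in phix0 phiy0 phixl phiyl.
have adjP' u v : S_adj n.+2 (phi u) (phi v) = S_adj m.+3 u v by exact: adjP.
suff fixed i (lt_im : i < m.+3) (lt_in : i < n.+2) :
    phi (inl (Ordinal lt_im)) = inl (Ordinal lt_in) /\
    phi (inr (Ordinal lt_im)) = inr (Ordinal lt_in).
  have lt_mm : m.+2 < m.+3 by [].
  have lt_mn' : m.+2 < n.+2 by exact: ltn_trans lt_mm lt_mn.
  have [+ _] := fixed _ lt_mm lt_mn'.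
  have -> : Ordinal lt_mm = ord_max by apply: val_inj.
  by rewrite phixl => -[]; lia.
elim/ltn_ind: i => i IH in lt_im lt_in *.
case: i => [|i] in IH lt_im lt_in *.
  split.
    have -> : Ordinal lt_im = ord0 by apply: val_inj.
    by rewrite phix0; congr inl; apply: val_inj.
  have -> : Ordinal lt_im = ord0 by apply: val_inj.
  by rewrite phiy0; congr inr; apply: val_inj.
have lt_im' : i < m.+3 by exact: ltnW.
have lt_in' : i < n.+2 by exact: ltnW.
have [IHx _] := IH i (ltnSn i) lt_im' lt_in'.
(* Target vertices of index at most [i] are already images, so any other source vertex lands beyond
   [i]. *)
have used_x (j : 'I_n.+2) (u : gV (S_graph m.+3)) : phi u = inl j ->
    (if u is inl k then i < k else true) -> i < j.
  move=> phiu ku; rewrite ltnNge; apply/negP => le_ji.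
  have lt_jm : j < m.+3 by exact: leq_ltn_trans le_ji lt_im'.
  have [Ex _] := IH j (leq_ltn_trans le_ji (ltnSn _)) lt_jm (ltn_ord j).
  have/inj_phi Eu : phi u = phi (inl (Ordinal lt_jm)).
    by rewrite Ex phiu; congr inl; apply: val_inj.
  by move: ku; rewrite Eu /= ltnNge le_ji.
have used_y (j : 'I_n.+2) (u : gV (S_graph m.+3)) : phi u = inr j ->
    (if u is inr k then i < k else true) -> i < j.
  move=> phiu ku; rewrite ltnNge; apply/negP => le_ji.
  have lt_jm : j < m.+3 by exact: leq_ltn_trans le_ji lt_im'.
  have [_ Ey] := IH j (leq_ltn_trans le_ji (ltnSn _)) lt_jm (ltn_ord j).
  have/inj_phi Eu : phi u = phi (inr (Ordinal lt_jm)).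
    by rewrite Ey phiu; congr inr; apply: val_inj.
  by move: ku; rewrite Eu /= ltnNge le_ji.
have yP : exists b, phi (inr (Ordinal lt_im)) = inr b.
  case Ey: (phi (inr (Ordinal lt_im))) => [a|b]; last by exists b.
  have := adjP' (inl ord0) (inr (Ordinal lt_im)); rewrite phix0 Ey /=.
  case: i => [|i] // in lt_im lt_in IH lt_im' lt_in' IHx used_x used_y Ey *.
  move=> _.
  (* Only y_1 could change sides; then x_1 would go to y_1 and y_1 to x_(n-2),
     which are adjacent only for n = 3. *)
  have := adjP' (inl (Ordinal lt_im)) (inr (Ordinal lt_im)); rewrite Ey /=.
  case Ex: (phi (inl (Ordinal lt_im))) => [//|b] /= adj_ab.
  have := adjP' (inl ord0) (inl (Ordinal lt_im)); rewrite phix0 Ex /= => /negbT nadj.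
  have := adjP' (inr (Ordinal lt_im)) (inr ord_max); rewrite phiyl Ey /= => /negbT nadj'.
  have b0 := used_y _ _ Ex isT.
  have a_neq : nat_of_ord a != n.+1.
    apply/eqP => Ea; have /inj_phi : phi (inr (Ordinal lt_im)) = phi (inl ord_max).
      by rewrite Ey phixl; congr inl; apply: val_inj.
    by [].
  have := ltn_ord a; have := ltn_ord b; lia.
have [b Ey] := yP.
(* [x_i] is fixed and not adjacent to [y_(i+1)]; beyond index [i], only [y_(i+1)] avoids [x_i]. *)
have Eb : b = Ordinal lt_in.
  have := used_y _ _ Ey (ltnSn i).
  have := adjP' (inl (Ordinal lt_im')) (inr (Ordinal lt_im)); rewrite IHx Ey /=.
  by move=> nadj lt_ib; apply: val_inj => /=; lia.
have := adjP' (inl (Ordinal lt_im)) (inr (Ordinal lt_im)); rewrite Ey /= eqxx.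
case Ex: (phi (inl (Ordinal lt_im))) => [a|//] /= adj_ab; split; last by rewrite Eb.
have lt_ia := used_x _ _ Ex (ltnSn i).
by congr inl; apply: val_inj; move: adj_ab; rewrite Eb /=; lia.
Qed.

(** Colours force corners onto corners. A path on four vertices has only the identity and the
    reversal as automorphisms, and it is not two disjoint edges, which disposes of [S_2]. *)
Lemma S_circ_antichain :
  infinite_antichain (lsub colour_le) (fun n => S_circ n.+2).
Proof.
move=> m n neq_mn [phi [[inj_phi adjP] labP]].
have lt_mn : m < n.
  by have := leq_card _ inj_phi; rewrite !card_sum !card_ord; lia.
case: n => // n in neq_mn phi inj_phi adjP labP lt_mn *.
have corner p : exists q, phi (S_corner m.+1 p) = S_corner n.+2 q.
  apply: S_corner_white.
  by have := labP (S_corner m.+1 p); rewrite /colour_le /= S_corner_lab => ->.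
have /fin_all_exists [pi piP] := corner.
have pi_inj : injective pi.
  by move=> p q Epq; apply/(@S_corner_inj m)/inj_phi; rewrite !piP Epq.
have adjC p q := adjP (S_corner m.+1 p) (S_corner m.+1 q).
have {adjC} adjC p q := adjC p q : S_adj _ _ _ = S_adj m.+2 _ _.
have {}adjC p q : (((pi p).1 (+) (pi q).1) &&
  (if (pi p).1 then (pi p).2 ==> (pi q).2 else (pi q).2 ==> (pi p).2)) =
  ((p.1 (+) q.1) && (if p.1 then (if m is 0 then p.2 == q.2 else p.2 ==> q.2)
   else (if m is 0 then p.2 == q.2 else q.2 ==> p.2))).
  by rewrite -S_corner_adj -adjC !piP (S_corner_adj n.+1).
have := adjC (true, false) (false, false).
have := adjC (true, false) (false, true).
have := adjC (true, true) (false, false).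
have := adjC (true, true) (false, true).
have := adjC (true, false) (true, true).
have := adjC (false, false) (false, true).
have : pi (true, false) != pi (true, true) by apply/eqP => /pi_inj.
have : pi (false, false) != pi (false, true) by apply/eqP => /pi_inj.
case E1: (pi (true, false)) => [[] []]; case E2: (pi (true, true)) => [[] []];
case E3: (pi (false, false)) => [[] []]; case E4: (pi (false, true)) => [[] []] //=;
  case: m => [|m] in neq_mn phi inj_phi adjP labP lt_mn corner pi piP pi_inj E1 E2 E3 E4 adjC *; try by [].
all: move=> _ _ _ _ _ _ _ _.
- have phiC p : phi (S_corner m.+2 p) = S_corner n.+2 p.
    by rewrite piP; case: p => [[] []]; rewrite ?E1 ?E2 ?E3 ?E4.
  have := @S_emb_fixed m n.+1 phi (conj inj_phi adjP) phiC; lia.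
(* The path of corners is reversed: compose with the reflection of the target. *)
- have [inj_rev adj_rev] := S_rev_emb n.+3.
  have emb_rev : @induced_emb (S_graph m.+3) (S_graph n.+3) (@S_rev _ \o phi).
    split; first by exact: inj_comp.
    by move=> u v; rewrite adj_rev adjP.
  suff revC p : S_rev (phi (S_corner m.+2 p)) = S_corner n.+2 p.
    have := @S_emb_fixed m n.+1 _ emb_rev revC; lia.
  rewrite piP; case: p => [[] []]; rewrite ?E1 ?E2 ?E3 ?E4 /=;
    rewrite /S_corner /=; congr (_ _); apply: val_inj => /=; lia.
Qed.

(** * Spirals in cyclically ordered chains *)


(* A chain is named by a pair: its side and its index on that side. *)
Definition ccomp (p q : bool * bool) := (p == q) || (p.1 (+) q.1).

(* The 4-cycle of chains, traversed in the direction [b]. *)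
Definition cnext (b : bool) (p : bool * bool) : bool * bool :=
  (~~ p.1, p.2 (+) p.1 (+) b).

(* Side, level, and whether the vertex lies below the only vertex of level 0. *)
Definition letter K := (bool * 'I_K * bool)%type.

(* The adjacency of two vertices with letters [l] and [m], the first one coming
   earlier in the word. *)
Definition decode K (l m : letter K) : bool :=
  (l.1.1 (+) m.1.1) &&
  ((if l.1.2 == 0 :> nat then ~~ m.2
    else if m.1.2 == 0 :> nat then l.2
    else if (m.1.2 <= l.1.2.+1) && (l.1.2 <= m.1.2.+1) then true
    else l.1.2 < m.1.2) == l.1.1).

Section CyclicOrder.
Variables (V : finType) (c : V -> bool * bool) (lt : rel V).

(** Transitivity is asked only when the ends are comparable too. The three vertices then occupy at
    most two chains, which leaves room for descents to wind around the 4-cycle. *)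
Definition cyclic_order :=
  [/\ forall x y, lt x y -> ccomp (c x) (c y), irreflexive lt,
      forall x y, ccomp (c x) (c y) -> x != y -> lt x y || lt y x &
      forall x y z, lt x y -> lt y z -> ccomp (c x) (c z) -> lt x z].

Definition co_adj (x y : V) := ((c x).1 (+) (c y).1) && (lt x y == (c x).1).

Hypothesis coV : cyclic_order.

Let ltC x y : lt x y -> ccomp (c x) (c y). Proof. by case: coV => + _ _ _; apply. Qed.
Let ltxx x : lt x x = false. Proof. by case: coV => _ + _ _; apply. Qed.
Let lt_total x y : ccomp (c x) (c y) -> x != y -> lt x y || lt y x.
Proof. by case: coV => _ _ + _; apply. Qed.
Let lt_trans x y z : lt x y -> lt y z -> ccomp (c x) (c z) -> lt x z.
Proof. by case: coV => _ _ _; apply. Qed.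

Let ccompxx p : ccomp p p. Proof. by rewrite /ccomp eqxx. Qed.
Let ccomp_sym p q : ccomp p q = ccomp q p.
Proof. by rewrite /ccomp eq_sym addbC. Qed.

Let lt_asym x y : lt x y -> lt y x = false.
Proof.
by move=> xy; apply/negP => yx; have := lt_trans xy yx (ccompxx _); rewrite ltxx.
Qed.

Let ltN x y : ccomp (c x) (c y) -> x != y -> lt x y = ~~ lt y x.
Proof.
move=> cxy nxy; have := lt_total cxy nxy.
by case: (boolP (lt x y)) => [xy|_ /= ->] //; rewrite lt_asym.
Qed.

Lemma exists_min (Y : {set V}) : Y != set0 ->
  {in Y &, forall x y, ccomp (c x) (c y)} ->
  exists2 m, m \in Y & {in Y, forall y, ~~ lt y m}.
Proof.
move=> /set0Pn [y0 y0Y] compY.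
case: (@arg_minnP _ y0 (mem Y) (fun m => #|[set y in Y | lt y m]|) y0Y) => m mY minm.
exists m => // y yY; apply/negP => ym; have := minm y yY; rewrite leqNgt => /negP; apply.
apply: proper_card; apply/properP; split.
  apply/subsetP => z; rewrite !inE => /andP [zY zy].
  by rewrite zY /= (lt_trans zy ym) // compY.
by exists y; rewrite !inE ?yY ?ltxx ?ym.
Qed.

Definition lower_closed (U X : {set V}) := {in X & U, forall x y, lt y x -> y \in X}.

Definition irreducible (U : {set V}) :=
  U != set0 /\ forall X : {set V}, X \subset U -> X != set0 -> lower_closed U X -> X = U.

(** Distant levels determine [lt] by themselves. Level 0 is exempt from this last clause, so it may
    hold only [z0], the comparison with which is recorded in the third component of a letter. *)
Definition levelled (U : {set V}) (lv : V -> nat) (z0 : V) :=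
  [/\ {in U, forall x, lv x = 0 -> x = z0},
      {in U &, forall x y, lv x = lv y -> c x = c y},
      {in U &, forall x y, lv y = (lv x).+1 -> (c y).1 = ~~ (c x).1} &
      {in U &, forall x y, ccomp (c x) (c y) -> 0 < lv x -> (lv x).+1 < lv y -> lt x y}].

Let cnext_cases b p q : ccomp q (cnext b p) ->
  [\/ q = cnext b p, q = cnext b (cnext b p) | q = p].
Proof.
by case: b; case: p => [[] []]; case: q => [[] []] //= _;
  solve [exact: Or31 | exact: Or32 | exact: Or33].
Qed.

Let cnext4 b p : cnext b (cnext b (cnext b (cnext b p))) = p.
Proof. by case: b; case: p => [[] []]. Qed.

Let cnext_cases0 b p q : ccomp q p -> [\/ q = p, q = cnext b p | q = cnext (~~ b) p].
Proof.
by case: b; case: p => [[] []]; case: q => [[] []] //= _;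
  solve [exact: Or31 | exact: Or32 | exact: Or33].
Qed.

(** * Levels of an irreducible set along a spiral *)

Section Levels.
Variables (U : {set V}) (z0 : V).
Hypotheses (irrU : irreducible U) (z0U : z0 \in U).
Hypothesis z0_min : {in U, forall y, c y = c z0 -> ~~ lt y z0}.

(** The ends of descents from [z0] that visit the chains in direction [b], one per step. Chains
    repeat with period 4, so a vertex may occur for many [t]. *)
Fixpoint level_set b t : {set V} :=
  if t is t'.+1 then
    [set y in U | (c y == iter t (cnext b) (c z0)) && [exists z in level_set b t', lt y z]]
  else [set z0].

Lemma level_setP b t y : y \in level_set b t -> y \in U /\ c y = iter t (cnext b) (c z0).
Proof.
by case: t => [|t] /=; rewrite !inE; [move/eqP->|move=> /and3P [-> /eqP -> _]].
Qed.

Lemma level_set_down b t y w : y \in level_set b t -> w \in U -> c w = c y ->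
  lt w y -> w \in level_set b t.
Proof.
case: t => [|t] /= yD wU cwy wy.
  move: yD cwy wy; rewrite inE => /eqP -> cwz wz.
  by have := z0_min wU cwz; rewrite wz.
move: yD; rewrite !inE => /and3P [yU /eqP cy /exists_inP [z zD yz]].
rewrite wU cwy cy eqxx /=; apply/exists_inP; exists z => //.
by apply: (lt_trans wy yz); rewrite cwy; exact: ltC.
Qed.

Lemma level_set_next b t y w : y \in level_set b t -> w \in U -> c w = cnext b (c y) ->
  lt w y -> w \in level_set b t.+1.
Proof.
move=> yD wU cw wy; have [_ cy] := level_setP yD.
by rewrite /= !inE wU cw cy eqxx /=; apply/exists_inP; exists y.
Qed.

Lemma level_set_prev b t y w : y \in level_set b t.+1 -> w \in U ->
  c w = iter t (cnext b) (c z0) -> lt w y -> w \in level_set b t.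
Proof.
rewrite /= !inE => /and3P [yU _ /exists_inP [z zD yz]] wU cw wy.
have [_ cz] := level_setP zD.
have cwz : c w = c z by rewrite cw cz.
by apply: (level_set_down zD) => //; apply: (lt_trans wy yz); rewrite cwz.
Qed.

Lemma level_set_winds b : z0 \in level_set b 4 ->
  forall t, level_set b t \subset level_set b t.+4.
Proof.
move=> z4; elim=> [|t IH]; apply/subsetP => y; first by rewrite inE => /eqP ->.
have it4 : iter t.+4 (cnext b) (c z0) = iter t (cnext b) (c z0) by rewrite !iterS cnext4.
move=> yD; move: (yD); rewrite /= inE => /and3P [yU /eqP cy /exists_inP [z /(subsetP IH) zD yz]].
apply: (level_set_next zD) => //.
by have [_ ->] := level_setP zD; rewrite it4 cy.
Qed.

(** The union of the level sets is a lower set of [U], hence all of [U] by irreducibility. *)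
Lemma level_set_cover b : z0 \in level_set b 4 ->
  {in U, forall y, exists t, y \in level_set b t}.
Proof.
move=> z4 y yU; pose E := [set w in U | `[< exists t, w \in level_set b t >]].
suff EU : E = U by move: yU; rewrite -EU inE => /andP [_ /asboolP].
case: irrU => _; apply.
- by apply/subsetP => w; rewrite inE => /andP [].
- by apply/set0Pn; exists z0; rewrite inE z0U /=; apply/asboolP; exists 0; rewrite inE.
move=> x w; rewrite inE => /andP [xU /asboolP [t xD]] wU wx.
rewrite inE wU /=; apply/asboolP.
(* Level 0 has no preceding chain; winding moves [x] to a positive level, from which [w] falls one
   level back, stays, or goes one further. *)
have {t xD}[t xD] : exists t, x \in level_set b t.+1.
  by exists t.+3; apply: (subsetP (level_set_winds z4 t)).
have [_ cx] := level_setP xD.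
have := ltC wx; rewrite cx iterS => /cnext_cases [] cw.
- by exists t.+1; apply: (level_set_down xD) => //; rewrite cx iterS.
- by exists t.+2; apply: (level_set_next xD) => //; rewrite cx iterS.
- by exists t; apply: (level_set_prev xD).
Qed.

Definition chained (lv : V -> nat) := forall t, {in U, forall y, lv y = t.+1 ->
  exists w, [/\ w \in U, lv w = t & lt y w]}.

(** The level of a vertex is the first [t] at which it occurs. A vertex below some [x] of positive
    level occurs at most one level later than [x], which gives the last clause of [levelled]. *)
Lemma levelled_winds b : z0 \in level_set b 4 ->
  exists lv, levelled U lv z0 /\ chained lv.
Proof.
move=> z4; have /fin_all_exists [lv lvP] : forall y, exists n, y \in U ->
    y \in level_set b n /\ forall m, y \in level_set b m -> n <= m.
  move=> y; case: (boolP (y \in U)) => [/(level_set_cover z4) exD|_]; last by exists 0.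
  by case: (ex_minnP exD) => n nD nP; exists n.
have lvD y : y \in U -> y \in level_set b (lv y) by move=> /lvP [].
have lv_min y m : y \in U -> y \in level_set b m -> lv y <= m.
  by move=> /lvP [_]; apply.
have lvc y : y \in U -> c y = iter (lv y) (cnext b) (c z0).
  by move=> /lvD /level_setP [].
exists lv; split; first split.
- by move=> x xU lv0; have := lvD x xU; rewrite lv0 inE => /eqP.
- by move=> x y xU yU Exy; rewrite (lvc x) // (lvc y) // Exy.
- by move=> x y xU yU Exy; rewrite (lvc x) // (lvc y) // Exy iterS.
- move=> x y xU yU cxy lvx lt_xy.
  have neq_xy : x != y by apply/eqP => Exy; rewrite Exy in lt_xy; lia.
  rewrite (ltN cxy neq_xy); apply/negP => yx.
  case E: (lv x) lvx => [//|s] _.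
  have xD := lvD x xU; rewrite E in xD.
  have cx := lvc x xU; rewrite E iterS in cx.
  move: cxy; rewrite ccomp_sym cx => /cnext_cases [] cy.
  + have := lv_min y s.+1 yU (level_set_down xD yU _ yx); rewrite cy cx => /(_ erefl); lia.
  + have := lv_min y s.+2 yU (level_set_next xD yU _ yx); rewrite cy cx => /(_ erefl); lia.
  + have := lv_min y s yU (level_set_prev xD yU cy yx); lia.
move=> t y yU lvy; have := lvD y yU; rewrite lvy /= !inE.
move=> /and3P [_ /eqP cy /exists_inP [w wD yw]].
have [wU cw] := level_setP wD; exists w; split=> //.
apply/eqP; rewrite eqn_leq lv_min //=.
have := lv_min y (lv w).+1 yU (level_set_next (lvD w wU) yU _ yw).
by rewrite cy cw lvy ltnS; apply; rewrite -cw lvc.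
Qed.

(** A vertex of level set 4 would pull [z0] into it, by minimality of [z0]; so descents in either
    direction stop before returning to the chain of [z0]. By irreducibility they reach all of
    [U]. *)
Lemma class_singleton : (forall b, z0 \notin level_set b 4) ->
  {in U, forall y, c y = c z0 -> y = z0}.
Proof.
move=> nwind.
have D4 b y : y \in level_set b 4 -> False.
  move=> yD; have [yU cy] := level_setP yD; rewrite /= cnext4 in cy.
  have [Eyz|neq] := eqVneq z0 y; first by move: yD; rewrite -Eyz; apply/negP/nwind.
  have z0y : lt z0 y by rewrite ltN ?cy //; exact: z0_min.
  by move: (nwind b); rewrite (level_set_down yD).
have Dlt b t y : y \in level_set b t -> t < 4.
  move=> yD; rewrite ltnNge; apply/negP => le4.
  suff [w wD] : exists w, w \in level_set b 4 by exact: D4 wD.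
  elim: t => [//|t IH] in y yD le4 *.
  have [Et|lt4] := eqVneq t.+1 4; first by exists y; rewrite -Et.
  move: yD; rewrite /= !inE => /and3P [_ _ /exists_inP [z zD _]].
  by apply: IH zD _; lia.
(* Both directions are joined because a vertex below [z0] may lie in either neighbouring chain. *)
pose E := [set w in U | `[< exists b t, w \in level_set b t >]].
have EU : E = U.
  case: irrU => _; apply.
  - by apply/subsetP => w; rewrite inE => /andP [].
  - apply/set0Pn; exists z0; rewrite inE z0U /=; apply/asboolP.
    by exists true, 0; rewrite inE.
  move=> x w; rewrite inE => /andP [xU /asboolP [b [t xD]]] wU wx.
  rewrite inE wU /=; apply/asboolP.
  have [_ cx] := level_setP xD; have := ltC wx; rewrite cx.
  case: t => [|t] in xD cx *.
    move=> /(cnext_cases0 b) [] cw.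
    - by exists b, 0; apply: (level_set_down xD) => //; rewrite cx.
    - by exists b, 1; apply: (level_set_next xD) => //; rewrite cx.
    - exists (~~ b), 1; apply: (level_set_next _ _ _ wx) => //=.
      by rewrite cx.
  rewrite iterS => /cnext_cases [] cw.
  - by exists b, t.+1; apply: (level_set_down xD) => //; rewrite cx iterS.
  - by exists b, t.+2; apply: (level_set_next xD) => //; rewrite cx iterS.
  - by exists b, t; apply: (level_set_prev xD).
move=> y; rewrite -EU inE => /andP [_ /asboolP [b [t yD]]] cy.
have [_] := level_setP yD; have := Dlt _ _ _ yD; rewrite cy.
case: t yD => [|[|[|[|]]]] //=; first by rewrite inE => /eqP.
all: by move=> _ _; case: (c z0) => [[] []]; case: b.
Qed.

(** Number the four chains around the cycle, starting at that of [z0]. Levels 1 and 3 are on the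
    same side in distinct chains, so the last clause is vacuous. *)
Lemma levelled_singleton : {in U, forall y, c y = c z0 -> y = z0} ->
  exists lv, levelled U lv z0 /\ forall x, lv x < 4.
Proof.
move=> single.
pose f p := if p == c z0 then 0 else if p == cnext true (c z0) then 1
  else if p == cnext false (c z0) then 3 else 2.
exists (f \o c); split; last by move=> x; rewrite /= /f; do !case: ifP.
split.
- move=> x xU; rewrite /= /f; case: eqP => [/single->//|_].
  by do !case: ifP.
- move=> x y _ _; rewrite /= /f.
  by case: (c x) => [[] []]; case: (c y) => [[] []]; case: (c z0) => [[] []].
- move=> x y _ _; rewrite /= /f.
  by case: (c x) => [[] []]; case: (c y) => [[] []]; case: (c z0) => [[] []].
- move=> x y _ _; rewrite /= /f.
  by case: (c x) => [[] []]; case: (c y) => [[] []]; case: (c z0) => [[] []].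
Qed.

Lemma irreducible_levelled :
  exists lv, levelled U lv z0 /\ ((forall x, lv x < 4) \/ chained lv).
Proof.
case: (boolP [exists b, z0 \in level_set b 4]) => [/existsP [b z4]|].
  by have [lv [lvP ch]] := levelled_winds z4; exists lv; split=> //; right.
rewrite negb_exists => /forallP nwind.
have [lv [lvP lt4]] := levelled_singleton (class_singleton nwind).
by exists lv; split=> //; left.
Qed.

End Levels.

(* Adjacent levels are linearly ordered by [lt]; as the levels form a path,
   these linear orders have a common linear extension. *)
Lemma levelled_min U lv z0 (X : {set V}) : levelled U lv z0 -> X \subset U -> X != set0 ->
  exists2 x, x \in X & {in X, forall y, lt y x -> lv y <= (lv x).+1 ->
    lv x <= (lv y).+1 -> False}.
Proof.
move=> [_ eqlv nextlv _] /subsetP XU X0.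
have level_min n : (exists2 x, x \in X & lv x = n) ->
    exists x, [/\ x \in X, lv x = n & {in X, forall y, lv y = n -> ~~ lt y x}].
  move=> [x0 x0X lvx0].
  have [||x] := @exists_min [set x in X | lv x == n].
  - by apply/set0Pn; exists x0; rewrite inE x0X lvx0 eqxx.
  - move=> x y; rewrite !inE => /andP [xX /eqP lvx] /andP [yX /eqP lvy].
    by rewrite (eqlv x y) ?XU // lvx.
  rewrite inE => /andP [xX /eqP lvx] minx; exists x; split=> // y yX lvy.
  by apply: minx; rewrite inE yX lvy eqxx.
(* Among the nearby levels, [good] ignores only the next one. A good vertex of maximal level is
   minimal there too: otherwise the least vertex of the next level would be good as well. *)
pose good x := (x \in X) &&
  [forall y in X, lt y x ==> ((lv y).+1 != lv x) && (lv y != lv x)].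
have goodP x : reflect (x \in X /\ forall y, y \in X -> lt y x ->
    (lv y).+1 <> lv x /\ lv y <> lv x) (good x).
  apply: (iffP andP) => -[xX gx]; split=> //.
    move=> y yX yx; move/forall_inP: gx => /(_ y yX) /implyP /(_ yx).
    by move=> /andP [/eqP ? /eqP].
  apply/forall_inP => y yX; apply/implyP => yx; have [? ?] := gx y yX yx.
  by apply/andP; split; apply/eqP.
have [x1 x1good] : exists x, good x.
  have [x0 x0X] := set0Pn _ X0.
  case: (@arg_minnP _ x0 (mem X) lv x0X) => m mX minm.
  have [x [xX lvx xmin]] := level_min (lv m) (ex_intro2 _ _ m mX erefl).
  exists x; apply/goodP; split=> // y yX yx; split.
    by have := minm y yX; rewrite lvx; lia.
  by rewrite lvx => lvy; have := xmin y yX lvy; rewrite yx.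
case: (@arg_maxnP _ x1 good lv x1good) => x /goodP [xX gx] maxx.
exists x => // y yX yx le1 le2; have [n1 n2] := gx y yX yx.
have lvy : lv y = (lv x).+1 by lia.
have [w [wX lvw wmin]] := level_min (lv x).+1 (ex_intro2 _ _ y yX lvy).
have : good w.
  apply/goodP; split=> // z zX zw; rewrite lvw; split=> [[lvz]|lvz]; last first.
    by have := wmin z zX lvz; rewrite zw.
  have wx : lt w x.
    have [->//|neq] := eqVneq w y.
    have cwy : c w = c y by apply: eqlv; rewrite ?XU // lvw.
    have wy : lt w y by rewrite ltN ?cwy //; apply: wmin.
    by apply: (lt_trans wy yx); rewrite cwy; exact: ltC.
  have czx : c z = c x by apply: eqlv; rewrite ?XU.
  have zx : lt z x by apply: (lt_trans zw wx); rewrite czx.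
  by have [] := gx z zX zx.
by move=> /maxx; rewrite /= lvw; lia.
Qed.

Lemma levelled_sort U lv z0 (X : {set V}) : levelled U lv z0 -> X \subset U ->
  exists s : seq V, [/\ uniq s, s =i X & pairwise (fun x y =>
    [|| ~~ lt y x, (lv x).+1 < lv y | (lv y).+1 < lv x]) s].
Proof.
move=> lvU; elim: {X}_.+1 {-2}X (ltnSn #|X|) => // n IH X; rewrite ltnS => le_n XU.
have [->|X0] := eqVneq X set0; first by exists [::]; split=> // x; rewrite inE.
have [x xX minx] := levelled_min lvU XU X0.
have [||s [uniq_s sX s_pair]] := IH (X :\ x).
- by rewrite (cardsD1 x) xX in le_n.
- by apply: subset_trans XU; exact: subD1set.
exists (x :: s); split=> /=.
- by rewrite sX !inE eqxx.
- by move=> y; rewrite inE sX !inE; case: eqVneq => // ->.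
- rewrite s_pair andbT; apply/allP => y; rewrite sX !inE => /andP [_ yX].
  have := minx y yX; case: (lt y x) => //= h; rewrite -implyNb; apply/implyP => h1.
  by rewrite ltnNge; apply/negP => h2; apply: h => //; lia.
Qed.

(** [decode] recovers [lt] from the position in the sorted list for near levels, from the levels
    themselves for distant ones, and from the recorded comparison with [z0] when level 0 is
    involved. *)
Lemma levelled_word (U : {set V}) lv z0 K : z0 \in U -> levelled U lv z0 ->
  {in U, forall x, lv x < K} ->
  exists s : seq (V * letter K), [/\ uniq (map fst s), map fst s =i U,
    {in s, forall p, p.2.1.1 = (c p.1).1} &
    pairwise (fun p q => co_adj p.1 q.1 == decode p.2 q.2) s].
Proof.
move=> z0U lvU ltK; have [s [uniq_s sU s_pair]] := levelled_sort lvU (subxx U).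
have K0 : 0 < K by exact: leq_ltn_trans (leq0n _) (ltK z0 z0U).
pose ord x : 'I_K := insubd (Ordinal K0) (lv x).
have ordE x : x \in U -> ord x = lv x :> nat.
  by move=> xU; rewrite val_insubd ltK.
pose f x := (x, ((c x).1, ord x, lt x z0)).
have fstf : map fst (map f s) = s by rewrite -map_comp map_id.
exists (map f s); rewrite fstf; split=> //; first by move=> p /mapP [x _ ->].
rewrite pairwise_map; apply/(pairwiseP z0) => i j lti ltj ij.
have xU : nth z0 s i \in U by rewrite -sU mem_nth.
have yU : nth z0 s j \in U by rewrite -sU mem_nth.
have := (pairwiseP z0 s_pair) i j lti ltj ij.
move: (nth z0 s i) (nth z0 s j) xU yU => x y xU yU near_xy.
rewrite /= /co_adj /decode /= !ordE //.
case sxy: ((c x).1 (+) (c y).1) => //=.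
have cxy : ccomp (c x) (c y) by rewrite /ccomp sxy orbT.
have neq : x != y by apply: contraTneq sxy => ->; rewrite addbb.
have [lv0 _ _ far] := lvU.
suff -> : lt x y = (if lv x == 0 then ~~ lt y z0 else if lv y == 0 then lt x z0
    else if (lv y <= (lv x).+1) && (lv x <= (lv y).+1) then true else lv x < lv y) by [].
have [/(lv0 x xU) Ex|x0] := eqVneq (lv x) 0; first by rewrite -Ex ltN.
have [/(lv0 y yU) Ey|y0] := eqVneq (lv y) 0; first by rewrite -Ey.
case: ifP => [/andP [le1 le2]|nnear].
  by rewrite ltN //; move: near_xy; rewrite !ltnNge le1 le2 /= !orbF.
clear near_xy s_pair lti ltj ij; case: (ltnP (lv x) (lv y)) => [ltlv|lelv].
  by apply: far => //; lia.
by apply: lt_asym; apply: far => //; [rewrite ccomp_sym|lia|lia].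
Qed.

(** The form in which an excluded [S_k] enters the word construction: it bounds the number of
    levels, hence the alphabet. *)
Definition short_helices K := forall U lv z0, levelled U lv z0 -> chained U lv ->
  {in U, forall x, lv x < K}.

Lemma irreducible_word U K : 4 <= K -> short_helices K -> irreducible U ->
  exists s : seq (V * letter K), [/\ uniq (map fst s), map fst s =i U,
    {in s, forall p, p.2.1.1 = (c p.1).1} &
    pairwise (fun p q => co_adj p.1 q.1 == decode p.2 q.2) s].
Proof.
move=> K4 short irrU; have /set0Pn [x0 x0U] := irrU.1.
have [||z0] := @exists_min [set y in U | c y == c x0].
- by apply/set0Pn; exists x0; rewrite inE x0U eqxx.
- by move=> x y; rewrite !inE => /andP [_ /eqP ->] /andP [_ /eqP ->].
rewrite inE => /andP [z0U /eqP cz0] minz0.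
have [|lv [lvU lvP]] := @irreducible_levelled U z0 irrU z0U.
  by move=> y yU cy; apply: minz0; rewrite inE yU cy cz0 eqxx.
apply: (levelled_word z0U lvU) => x xU.
case: lvP => [lt4|ch]; first exact: leq_trans (lt4 x) K4.
exact: short lvU ch x xU.
Qed.

(** The earlier block lies below the later one, so vertices on opposite sides are adjacent exactly
    when the left one comes first. *)
Definition between_blocks K (p q : V * letter K) :=
  co_adj p.1 q.1 == p.2.1.1 && ~~ q.2.1.1.

(** Repeatedly splitting off a proper nonempty lower set, listed before its complement, ends in
    irreducible blocks. *)
Lemma block_words (U : {set V}) K : 4 <= K -> short_helices K ->
  exists ss : seq (seq (V * letter K)), [/\ uniq (map fst (flatten ss)),
    map fst (flatten ss) =i U,
    {in flatten ss, forall p, p.2.1.1 = (c p.1).1},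
    pairwise (fun s t => allrel (@between_blocks K) s t) ss &
    all (pairwise (fun p q => co_adj p.1 q.1 == decode p.2 q.2)) ss].
Proof.
move=> K4 short; elim: {U}_.+1 {-2}U (ltnSn #|U|) => // n IH U; rewrite ltnS => le_n.
have [->|U0] := eqVneq U set0; first by exists [::]; split=> // x; rewrite inE.
case: (pselect (irreducible U)) => [irrU|nirr].
  have [s [uniq_s sU side pw]] := irreducible_word K4 short irrU.
  by exists [:: s]; rewrite /= cats0 pw; split.
have [X [XU X0 closed XnU]] : exists X : {set V},
    [/\ X \subset U, X != set0, lower_closed U X & X != U].
  apply: contrapT => nX; apply: nirr; split=> // X XU X0 closed; apply/eqP.
  by apply: contrapT => /negP XnU; apply: nX; exists X.
have ltX : #|X| < #|U| by apply: proper_card; rewrite properEneq XnU.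
have ltC' : #|U :\: X| < #|U|.
  by rewrite -(cardsID X U) (setIidPr XU) -addn1 addnC leq_add2r card_gt0.
have [ss1 [u1 e1 s1 p1 a1]] := IH X (leq_trans ltX le_n).
have [ss2 [u2 e2 s2 p2 a2]] := IH (U :\: X) (leq_trans ltC' le_n).
exists (ss1 ++ ss2); rewrite flatten_cat map_cat; split.
- rewrite cat_uniq u1 u2 andbT /=; apply/hasPn => x; rewrite e2 !inE => /andP [xX _].
  by rewrite /= e1.
- move=> x; rewrite mem_cat e1 e2 !inE; case: (boolP (x \in X)) => // xX /=.
  by rewrite (subsetP XU).
- by move=> p; rewrite mem_cat => /orP [/s1|/s2].
- rewrite pairwise_cat p1 p2 !andbT; apply/allrelP => s t ss1s ss2t.
  apply/allrelP => p q ps qt.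
  have pss : p \in flatten ss1 by apply/flattenP; exists s.
  have qss : q \in flatten ss2 by apply/flattenP; exists t.
  have := map_f fst pss; have := map_f fst qss; rewrite e1 e2 !inE => /andP [qX qU] pX.
  rewrite /between_blocks (s1 p) // (s2 q) // /co_adj.
  case spq: ((c p.1).1 (+) (c q.1).1); last by move: spq; do 2!case: (c _).1.
  have -> : lt p.1 q.1.
    rewrite ltN; last 2 first.
    - by rewrite /ccomp spq orbT.
    - by apply: contraTneq spq => ->; rewrite addbb.
    by apply: contra qX => /closed; apply.
  by move: spq; do 2!case: (c _).1.
- by rewrite all_cat a1 a2.
Qed.

End CyclicOrder.

(** * Encoding bichain graphs by words of words *)


Lemma pairwise_flatten (T : Type) (r : rel T) (ss : seq (seq T)) :
  pairwise r (flatten ss) = pairwise (fun s t => allrel r s t) ss && all (pairwise r) ss.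
Proof.
elim: ss => //= s ss IH; rewrite pairwise_cat IH.
have -> : allrel r s (flatten ss) = all (fun t => allrel r s t) ss.
  by elim: ss {IH} => [|t ss IH] /=; rewrite ?allrel0r // allrel_catr IH.
by case: all => //=; rewrite andbCA.
Qed.

Lemma subseq_flatten (T : eqType) (ss tt : seq (seq T)) :
  subseq ss tt -> subseq (flatten ss) (flatten tt).
Proof.
elim: tt ss => [|t tt IH] [|s ss] //=; first by rewrite sub0seq.
case: eqP => [-> /IH sub|_ /IH sub]; first exact: cat_subseq.
exact: (subseq_trans sub (suffix_subseq _ _)).
Qed.

(** This turns the recursive [emb] into an explicit list of matched pairs, from which a vertex map
    can be read off. *)
Lemma emb_pairing (P P' : eqType) (X : Type) (le : X -> X -> Prop) (f : P -> X)
    (g : P' -> X) (u : seq P) (v : seq P') : emb le (map f u) (map g v) ->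
  exists z : seq (P * P'), [/\ map fst z = u, subseq (map snd z) v &
    {in z, forall p, le (f p.1) (g p.2)}].
Proof.
elim: v u => [|y v IH] u /=; first by case: u => // _; exists [::].
case=> [/IH [z [Ez subz lez]]|].
  by exists z; split=> //; exact: (subseq_trans subz (subseq_cons _ _)).
case: u => //= x u [lexy /IH [z [Ez subz lez]]]; exists ((x, y) :: z); split=> /=.
- by rewrite Ez.
- by rewrite eqxx.
- by move=> p; rewrite inE => /predU1P [->|/lez].
Qed.

Lemma uniq_map_inj (T T' : eqType) (f : T -> T') (s : seq T) :
  uniq (map f s) -> {in s &, injective f}.
Proof.
elim: s => //= x s IH /andP [xs us] y z; rewrite !inE.
move=> /predU1P [->|ys] /predU1P [->|zs] // Ef; last exact: IH.
- by case/negP: xs; rewrite Ef map_f.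
- by case/negP: xs; rewrite -Ef map_f.
Qed.

Section Encoding.
Variable K : nat.

Definition encoding (G : graph) (ss : seq (seq (gV G * letter K))) :=
  [/\ uniq (map fst (flatten ss)),
    (forall x, x \in map fst (flatten ss)),
    pairwise (fun s t => allrel
      (fun p q => gadj G p.1 q.1 == p.2.1.1 && ~~ q.2.1.1) s t) ss &
    all (pairwise (fun p q => gadj G p.1 q.1 == decode p.2 q.2)) ss].

Definition encode (W : Type) (G : lgraph W) (ss : seq (seq (gV (lg G) * letter K))) :
    seq (seq (letter K * W)) :=
  map (map (fun p => (p.2, lab G p.1))) ss.

(** Matched vertices carry equal letters, and the matching respects order and blocks. Adjacency
    depends on nothing else, so it is preserved. *)
Lemma emb_lsub (W : Type) (le : W -> W -> Prop) (G H : lgraph W) ss tt :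
  encoding (G := lg G) ss -> encoding (G := lg H) tt ->
  emb (emb (lab_le le)) (encode ss) (encode tt) -> lsub le G H.
Proof.
move=> [uniqG allG crossG inG] [uniqH _ crossH inH] /emb_pairing [zz [zz1 zz2 zzP]].
pose cells := seq ((gV (lg G) * letter K) * (gV (lg H) * letter K)).
have /choice [h hP] : forall q, exists z : cells, q \in zz ->
    [/\ map fst z = q.1, subseq (map snd z) q.2 &
      {in z, forall p, lab_le le (p.1.2, lab G p.1.1) (p.2.2, lab H p.2.1)}].
  move=> q; case: (boolP (q \in zz)) => [/zzP /emb_pairing [z zP]|_]; last by exists [::].
  by exists z.
pose z := flatten (map h zz).
have zfst : map fst z = flatten ss.
  rewrite map_flatten -zz1 -map_comp; congr flatten; apply/eq_in_map => q qz /=.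
  by have [] := hP q qz.
have zsnd : subseq (map snd z) (flatten tt).
  apply: (subseq_trans _ (subseq_flatten zz2)).
  rewrite map_flatten -map_comp; elim: (zz) hP => //= q zz' IH hP.
  apply: cat_subseq; first by have [] := hP q (mem_head _ _).
  by apply: IH => r rz; apply: hP; rewrite inE rz orbT.
have zlab : {in z, forall p, lab_le le (p.1.2, lab G p.1.1) (p.2.2, lab H p.2.1)}.
  move=> p /flattenP [s /mapP [q qz ->]] ps; have [_ _] := hP q qz; exact.
have zpair : pairwise (fun p q =>
    gadj (lg G) p.1.1 q.1.1 == gadj (lg H) p.2.1 q.2.1) z.
  (* Pairs from different blocks follow the crossing rule, pairs from one block follow [decode]. *)
  rewrite pairwise_flatten; apply/andP; split.
    rewrite pairwise_map; move: crossG crossH; rewrite -zz1 pairwise_map => crossG.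
    move=> /(subseq_pairwise zz2); rewrite pairwise_map => crossH.
    have := conj crossG crossH => /andP; rewrite -pairwise_relI.
    apply: (@sub_in_pairwise _ (mem zz)); last exact/allP.
    move=> q r qz rz /= /andP [/allrelP adjG /allrelP adjH].
    have [q1 q2 q3] := hP q qz; have [r1 r2 r3] := hP r rz.
    apply/allrelP => a b az bz.
    have aq : a.1 \in q.1 by rewrite -q1 map_f.
    have br : b.1 \in r.1 by rewrite -r1 map_f.
    have /eqP -> := adjG a.1 b.1 aq br.
    have /eqP -> := adjH a.2 b.2 (mem_subseq q2 (map_f _ az)) (mem_subseq r2 (map_f _ bz)).
    by have [/= -> _] := q3 a az; have [/= -> _] := r3 b bz.
  apply/allP => s /mapP [q qz ->]; have [q1 q2 q3] := hP q qz.
  have qss : q.1 \in ss by rewrite -zz1 map_f.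
  have qtt : q.2 \in tt by apply: (mem_subseq zz2); rewrite map_f.
  have := allP inG _ qss; rewrite -q1 pairwise_map => pG.
  have := subseq_pairwise q2 (allP inH _ qtt); rewrite pairwise_map => pH.
  have := conj pG pH => /andP; rewrite -pairwise_relI.
  apply: (@sub_in_pairwise _ (mem (h q))); last exact/allP.
  move=> a b az bz /= /andP [/eqP -> /eqP ->].
  by have [/= -> _] := q3 a az; have [/= -> _] := q3 b bz.
have uniq1 : uniq (map (fun p => p.1.1) z).
  by rewrite (map_comp fst fst) zfst.
have uniq2 : uniq (map (fun p => p.2.1) z).
  by rewrite (map_comp fst snd); exact: (subseq_uniq (map_subseq fst zsnd) uniqH).
have /fin_all_exists [phi phiP] : forall x, exists y,
    exists2 p, p \in z & p.1.1 = x /\ p.2.1 = y.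
  move=> x; have := allG x; rewrite -zfst -map_comp => /mapP [p pz ->].
  by exists p.2.1, p.
exists phi; split; first split.
- move=> x y; have [p pz [<- <-]] := phiP x; have [q qz [<- <-]] := phiP y.
  by move/(uniq_map_inj uniq2 pz qz) ->.
- move=> x y; have [p pz [<- <-]] := phiP x; have [q qz [<- <-]] := phiP y.
  have [->|neq] := eqVneq p q; first by rewrite !girr.
  have := pairwiseP p zpair => adjP.
  have := index_mem p z; have := index_mem q z; rewrite pz qz => ltq ltp.
  case: (ltngtP (index p z) (index q z)) => [lt_pq|lt_qp|Epq].
  + by have := adjP _ _ ltp ltq lt_pq; rewrite !nth_index // => /eqP.
  + have := adjP _ _ ltq ltp lt_qp; rewrite !nth_index // => /eqP.
    by rewrite gsym [RHS]gsym => ->.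
  + by case/eqP: neq; rewrite -(nth_index p pz) Epq nth_index.
- by move=> x; have [p pz [<- <-]] := phiP x; have [_] := zlab p pz.
Qed.

End Encoding.

(** * Bichain graphs as cyclically ordered chains *)

Lemma bichain_cyclic_order (G : graph) : bichain G ->
  exists (c : gV G -> bool * bool) (lt : rel (gV G)),
    cyclic_order c lt /\ forall x y, gadj G x y = co_adj c lt x y.
Proof.
move=> [A1 [A2 [B1 [B2 [disj [cover [indA [indB [chA1 [chA2 [chB1 chB2]]]]]]]]]]].
pose c v := (v \in A1 :|: A2, if v \in A1 :|: A2 then v \in A1 else v \in B1).
have inB v : (c v).1 = false -> v \in B1 :|: B2.
  by move=> /= cv; have := in_setT v; rewrite -cover in_setU cv.
have chain u v : c u = c v -> nbhd u \subset nbhd v \/ nbhd v \subset nbhd u.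
  move=> Ecuv; have := congr1 fst Ecuv; have := congr1 snd Ecuv => /=.
  case cu: (u \in A1 :|: A2); case cv: (v \in A1 :|: A2) => // + _.
    move: cu cv; rewrite !inE; case u1: (u \in A1); case v1: (v \in A1) => //= u2 v2 _.
      exact: chA1.
    exact: chA2.
  have := inB u cu; have := inB v cv.
  rewrite !inE; case u1: (u \in B1); case v1: (v \in B1) => //= v2 u2 _.
    exact: chB1.
  exact: chB2.
have inA v : (c v).1 = true -> v \in A1 :|: A2 by [].
clearbody c.
(* Lexicographic order by neighbourhood size, then rank: the rank separates twins without disturbing
   inclusion. *)
pose key (u : gV G) := #|nbhd u| * #|gV G| + enum_rank u.
have key_inj : injective key.
  move=> u v Ekey; apply/enum_rank_inj/val_inj.
  have := congr1 (modn^~ #|gV G|) Ekey.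
  by rewrite /key !modnMDl !modn_small // ltn_ord.
have key_sub u v : c u = c v -> key u <= key v -> nbhd u \subset nbhd v.
  move=> cuv le_uv; have : #|nbhd u| <= #|nbhd v|.
    have V0 : 0 < #|gV G| by apply/card_gt0P; exists u.
    have := leq_div2r #|gV G| le_uv.
    by rewrite /key !divnMDl // !divn_small ?addn0 // ltn_ord.
  case: (chain u v cuv) => // sub le; suff -> : nbhd v = nbhd u by [].
  by apply/eqP; rewrite eqEcard sub.
(* An early vertex has many neighbours if it is on the left and few if it is on the right, so [key]
   is reversed on the left. *)
pose lt (u v : gV G) := if (c u).1 (+) (c v).1 then gadj G u v == (c u).1
  else (c u == c v) && (if (c u).1 then key v < key u else key u < key v).
have adj_sub u v w : c u = c v -> key u <= key v -> gadj G u w -> gadj G v w.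
  by move=> cuv le; have := subsetP (key_sub u v cuv le) w; rewrite !inE.
exists c, lt; split; first split.
- move=> x y; rewrite /lt /ccomp; case: ifP => [_ _|_ /andP [-> //]]; exact: orbT.
- by move=> x; rewrite /lt addbb ltnn; case: ifP; rewrite andbF.
- move=> x y; rewrite /lt /ccomp [(c y).1 (+) _]addbC.
  case sxy: ((c x).1 (+) (c y).1) => /=.
    by move=> _ _; rewrite (gsym y x); move: sxy; case: (c x).1; case: (c y).1; case: gadj.
  rewrite orbF => /eqP Ec neq; rewrite Ec eqxx /=.
  have : key x != key y by apply: contra neq => /eqP /key_inj ->.
  by case: (c y).1; rewrite neq_ltn // orbC.
- move=> x y z; rewrite /lt /ccomp.
  case sxy: ((c x).1 (+) (c y).1); case syz: ((c y).1 (+) (c z).1).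
  + have -> : (c x).1 (+) (c z).1 = false.
      by move: sxy syz; case: (c x).1; case: (c y).1; case: (c z).1.
    have cyx : (c y).1 = ~~ (c x).1 by move: sxy; case: (c x).1; case: (c y).1.
    rewrite orbF cyx => /eqP axy /eqP ayz /eqP Ec; rewrite Ec eqxx /= -Ec.
    rewrite gsym in ayz.
    case s: (c x).1 axy ayz => /= axy ayz; rewrite ltnNge; apply/negP => le.
      by rewrite (adj_sub _ _ _ Ec le axy) in ayz.
    by rewrite (adj_sub _ _ _ (esym Ec) le ayz) in axy.
  + have -> : (c x).1 (+) (c z).1 = true.
      by move: sxy syz; case: (c x).1; case: (c y).1; case: (c z).1.
    have cyx : (c y).1 = ~~ (c x).1 by move: sxy; case: (c x).1; case: (c y).1.
    rewrite cyx => /eqP axy /andP [/eqP Ec] + _.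
    rewrite gsym in axy; rewrite gsym; case s: (c x).1 axy => /= axy lt_yz.
      by rewrite (adj_sub _ _ _ Ec (ltnW lt_yz)).
    by apply/eqP/negbTE; apply: contraFN axy; exact: adj_sub (esym Ec) (ltnW lt_yz).
  + have -> : (c x).1 (+) (c z).1 = true.
      by move: sxy syz; case: (c x).1; case: (c y).1; case: (c z).1.
    move=> /andP [/eqP Ec] + /eqP ayz _; rewrite Ec in ayz *.
    case s: (c y).1 ayz => /= ayz lt_xy.
      by rewrite (adj_sub _ _ _ (esym Ec) (ltnW lt_xy)).
    by apply/eqP/negbTE; apply: contraFN ayz; exact: adj_sub Ec (ltnW lt_xy).
  + have -> : (c x).1 (+) (c z).1 = false.
      by move: sxy syz; case: (c x).1; case: (c y).1; case: (c z).1.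
    move=> /andP [/eqP Exy +] /andP [/eqP Eyz +] _; rewrite Exy Eyz eqxx /=.
    by case: (c z).1; lia.
move=> x y; rewrite /co_adj /lt.
case sxy: ((c x).1 (+) (c y).1) => /=; first by case: gadj; case: (c x).1.
apply/negbTE; move: sxy; case cx: (c x).1; case cy: (c y).1 => // _.
  by apply: indA; apply: inA.
by apply: indB; apply: inB.
Qed.

(** A vertex of level at least [2k+1] yields vertices [w s] of all lower levels [s], consecutive
    ones descending and distant comparable ones of positive level ascending. Taken alternately as
    [y_j] and [x_i], they induce [S_k]. *)
Lemma S_graph_helix (G : graph) c lt k : cyclic_order c lt ->
  (forall x y, gadj G x y = co_adj c lt x y) -> 0 < k ->
  ~ induced_sub (S_graph k) G -> @short_helices _ c lt k.*2.+1.
Proof.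
move=> coG adjE k0 noS U lv z0 [_ _ nextlv farlv] ch x xU.
rewrite ltnNge; apply/negP => le_x; apply: noS.
have chain t : {in U, forall y, lv y = t -> exists w : nat -> gV G, w t = y /\
    forall s, s <= t -> [/\ w s \in U, lv (w s) = s & s < t -> lt (w s.+1) (w s)]}.
  elim: t => [|t IH] y yU lvy.
    exists (fun=> y); split=> // s; rewrite leqn0 => /eqP ->; split=> //.
  have [v [vU lvv yv]] := ch t y yU lvy.
  have [w [wt wP]] := IH v vU lvv.
  exists (fun s => if s <= t then w s else y); split; first by rewrite ltnn.
  move=> s; rewrite leq_eqVlt ltnS => /predU1P [->|le_st].
    by rewrite !ltnn; split.
  have [wsU lvws lts] := wP s le_st; rewrite le_st; split=> // _.
  case: ltnP => [/lts //|le_ts].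
  have -> : s = t by apply/eqP; rewrite eqn_leq le_st.
  by rewrite wt.
have [w [_ wP]] := chain (lv x) x xU erefl.
have {wP}wP s : s <= k.*2.+1 ->
    [/\ w s \in U, lv (w s) = s & s <= k.*2 -> lt (w s.+1) (w s)].
  move=> le_s; have [|? ? lts] := wP s; first exact: leq_trans le_s le_x.
  by split=> // le_s2; apply: lts; exact: leq_trans le_x.
have side s : s <= k.*2 -> (c (w s.+1)).1 = ~~ (c (w s)).1.
  move=> le_s; have [sU lvs _] := wP s (leqW le_s); have [tU lvt _] := wP s.+1 le_s.
  by apply: nextlv => //; rewrite lvt lvs.
(* The spiral starts at a positive level on the right side, level 0 being exempt from the far rule;
   [e <= 2] keeps the last index [2(k-1)+e+1] within [2k+1]. *)
have [e [e0 e2 eB]] : exists e, [/\ 0 < e, e <= 2 & (c (w e)).1 = false].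
  case s1: (c (w 1)).1; last by exists 1.
  by exists 2; split=> //; rewrite side ?s1 //; lia.
have sideB i : i < k -> (c (w (i.*2 + e))).1 = false.
  elim: i => [//|i IH] lt_ik; rewrite doubleS !addSn !side ?IH //; lia.
have sideA i : i < k -> (c (w (i.*2 + e).+1)).1 = true.
  by move=> lt_ik; rewrite side ?sideB //; lia.
have far s t : 0 < s -> s.+1 < t -> t <= k.*2.+1 -> (c (w s)).1 (+) (c (w t)).1 ->
    lt (w s) (w t).
  move=> s0 st tk sst; have [|sU lvs _] := wP s; first lia.
  have [tU lvt _] := wP t tk.
  by apply: farlv; rewrite ?lvs ?lvt // /ccomp sst orbT.
pose phi (v : gV (S_graph k)) :=
  match v with inl i => w (i.*2 + e).+1 | inr j => w (j.*2 + e) end.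
have w_inj s t : s <= k.*2.+1 -> t <= k.*2.+1 -> w s = w t -> s = t.
  by move=> /wP [_ ls _] /wP [_ lt' _] Est; rewrite -ls -lt' Est.
have lt_asym a b : lt a b -> lt b a = false.
  case: coG => ltC ltxx _ lttr ab; apply/negP => ba.
  by have := lttr _ _ _ ab ba; rewrite ltxx /ccomp eqxx; move/(_ isT).
(* Consecutive descents give the edge for [j = i] and the non-edge for [j = i+1]; all other pairs
   are at distant levels. *)
have adjAB (i j : 'I_k) : gadj G (w (i.*2 + e).+1) (w (j.*2 + e)) =
    (nat_of_ord j == nat_of_ord i) || (i.+2 <= j).
  have lti := ltn_ord i; have ltj := ltn_ord j.
  rewrite adjE /co_adj sideA // sideB //= eqb_id.
  case: eqVneq => [->|neq] /=.
    by have [|_ _] := wP (i.*2 + e); [lia|apply; lia].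
  case: ltnP => le; first by apply: far; rewrite ?sideA ?sideB //; lia.
  apply: lt_asym; have [Ej|neq'] := eqVneq (nat_of_ord j) i.+1.
    by have [|_ _] := wP (i.*2 + e).+1; [lia|rewrite Ej doubleS !addSn; apply; lia].
  by apply: far; rewrite ?sideA ?sideB //; lia.
exists phi; split.
  move=> [i|i] [j|j] /= /w_inj; have := ltn_ord i; have := ltn_ord j => ltj lti Eij.
  - by congr inl; apply: val_inj => /=; lia.
  - lia.
  - lia.
  - by congr inr; apply: val_inj => /=; lia.
move=> [i|i] [j|j] /=; rewrite ?adjAB //.
- by rewrite adjE /co_adj !sideA.
- by rewrite gsym adjAB.
- by rewrite adjE /co_adj !sideB.
Qed.

(* The family S_k^o, k >= 2 (indexed as n |-> S_(n+2)^o), is a canonical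
   labelled infinite antichain for the class of bichain graphs. *)
Theorem theorem19 :
  canonical_antichain bichain colour_le (fun n => S_circ n.+2).
Proof.
split.
  split; first exact: colour_wqo.
  by split=> [n|]; [exact: S_graph_bichain|exact: S_circ_antichain].
move=> D herD DC [N noS] W le wle [A [AD antiA]].
(* This is [2k+1] for [k = N+2], as [S_(N+2)] is not in [D]. *)
pose K := N.+2.*2.+1.
have /choice [enc encP] : forall i, exists u, exists2 ss,
    @encoding K (lg (A i)) ss & u = encode ss.
  move=> i; have [c [lt [co adjE]]] := bichain_cyclic_order (DC _ (AD i)).
  have short : short_helices c lt K.
    apply: S_graph_helix => // sub; apply: (noS N (leqnn N)).
    exact: herD (AD i) sub.
  have [//|ss [uniq_ss ssT side cross inner]] :=
    block_words co [set: gV (lg (A i))] _ short.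
  exists (encode ss); exists ss => //; split=> //.
  - by move=> x; rewrite ssT inE.
  - apply: sub_pairwise cross => s t; apply: sub_allrel => p q.
    by rewrite /between_blocks adjE.
  - apply: sub_all inner => s; apply: sub_pairwise => p q.
    by rewrite adjE.
have [_ good] := higman (higman (wqo_lab (letter K) wle)).
have [i [j [lt_ij embij]]] := good enc.
apply: (antiA i j); first by move=> Eij; rewrite Eij ltnn in lt_ij.
have [ss ssP Ei] := encP i; have [tt ttP Ej] := encP j.
by rewrite Ei Ej in embij; exact: emb_lsub embij.
Qed.
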